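(* Fix string indices $i,j$, row variables $x_i,x_j$ and a single column variable $a$. For every choice of a set $S$ of exactly three of the six external edges $\alpha,\beta,\gamma,\delta,\epsilon,\zeta$, the sum of the weights of all states of the left configuration $L$ with boundary condition $S$ equals the sum of the weights of all states of the right configuration $R$ with boundary condition $S$.
   Context: Each configuration has three vertices (oxygen atoms), three internal edges and six external edges labelled $\alpha,\beta,\gamma,\delta,\epsilon,\zeta$; every edge carries one hydrogen atom bonded to exactly one of its endpoints. The boundary condition $S$ specifies that the hydrogen on an external edge is bonded to the configuration's vertex on that edge iff the edge lies in $S$. A state is a choice, for each internal edge, of which endpoint its hydrogen is bonded to, such that every vertex is bonded to exactly two of the hydrogens on its four incident edges. The weight of a state is the product of the weights of its three vertices. Configuration $L$: a diagonal vertex $D$, an upper rectilinear vertex $U$ and a lower rectilinear vertex $W$. String $i$ enters $D$ through its south-west edge $\alpha$ (external) and leaves through its north-east edge, which is joined (internal edge) to the west edge of $U$; the east edge of $U$ is external $\delta$. String $j$ enters $D$ through its north-west edge $\beta$ (external) and leaves through its south-east edge, joined (internal edge) to the west edge of $W$; the east edge of $W$ is external $\epsilon$. A vertical line passes through $U$ and $W$: the north edge of $U$ is external $\gamma$, the south edge of $U$ and north edge of $W$ form an internal edge, the south edge of $W$ is external $\zeta$. Thus $U$ lies on string $i$ and $W$ on string $j$. Configuration $R$: an upper rectilinear vertex $U'$, a lower rectilinear vertex $W'$ and a diagonal vertex $D'$. The west edge of $U'$ is external $\beta$, the west edge of $W'$ is external $\alpha$, the north edge of $U'$ is external $\gamma$,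 the south edge of $W'$ is external $\zeta$, the south edge of $U'$ and north edge of $W'$ form an internal edge. The east edge of $W'$ is joined to the south-west edge of $D'$ and the east edge of $U'$ to the north-west edge of $D'$ (internal edges); the north-east edge of $D'$ is external $\delta$ and its south-east edge is external $\epsilon$. Thus string $i$ runs $\alpha\to W'\to D'$ (south-west to north-east) $\to\delta$, and string $j$ runs $\beta\to U'\to D'$ (north-west to south-east) $\to\epsilon$; $W'$ lies on string $i$ and $U'$ on string $j$. Weights of a rectilinear vertex on string $k\in\{i,j\}$ (with column variable $a$): $x_k/a$ if its two bonded hydrogens are on its north and south edges; $x_k/a-1$ if they are on its north and west edges; $1$ otherwise. Weights of a diagonal vertex (string $i$ running south-west to north-east, string $j$ north-west to south-east), according to the pair of edges carrying its two bonded hydrogens: south-west & north-east: $1/x_i$; north-west & south-east: $1/x_j$; north-west & north-east: $1/x_i-1/x_j$; south-west & south-east: $0$; south-east & north-east: $1/x_i$; south-west & north-west: $1/x_j$. *)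

(* Defs.v *)
From HB Require Import structures.
From mathcomp Require Import all_boot all_algebra.

Set Implicit Arguments.
Unset Strict Implicit.
Unset Printing Implicit Defensive.

Import GRing.Theory.
Local Open Scope ring_scope.

Inductive vertex := Diag | Upper | Lower.

Inductive extEdge := Alpha | Beta | Gamma | Delta | Epsilon | Zeta.

(* Both configurations have the same internal edges, each named after the two
   vertices that it joins. *)
Inductive intEdge := DiagUpper | DiagLower | UpperLower.

Inductive rectDir := North | South | West | East.

Inductive diagDir := SouthWest | NorthEast | NorthWest | SouthEast.

Definition nat_of_vertex v : nat :=
  match v with Diag => 0 | Upper => 1 | Lower => 2 end.
Definition vertex_of_nat := nth Diag [:: Diag; Upper; Lower].
Lemma nat_of_vertexK : cancel nat_of_vertex vertex_of_nat.
Proof. by case. Qed.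
HB.instance Definition _ := Countable.copy vertex (can_type nat_of_vertexK).
Lemma vertex_enumP : Finite.axiom [:: Diag; Upper; Lower].
Proof. by case. Qed.
HB.instance Definition _ := isFinite.Build vertex vertex_enumP.

Definition nat_of_extEdge e : nat :=
  match e with
  | Alpha => 0 | Beta => 1 | Gamma => 2 | Delta => 3 | Epsilon => 4 | Zeta => 5
  end.
Definition extEdge_of_nat :=
  nth Alpha [:: Alpha; Beta; Gamma; Delta; Epsilon; Zeta].
Lemma nat_of_extEdgeK : cancel nat_of_extEdge extEdge_of_nat.
Proof. by case. Qed.
HB.instance Definition _ := Countable.copy extEdge (can_type nat_of_extEdgeK).
Lemma extEdge_enumP :
  Finite.axiom [:: Alpha; Beta; Gamma; Delta; Epsilon; Zeta].
Proof. by case. Qed.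
HB.instance Definition _ := isFinite.Build extEdge extEdge_enumP.

Definition nat_of_intEdge e : nat :=
  match e with DiagUpper => 0 | DiagLower => 1 | UpperLower => 2 end.
Definition intEdge_of_nat :=
  nth DiagUpper [:: DiagUpper; DiagLower; UpperLower].
Lemma nat_of_intEdgeK : cancel nat_of_intEdge intEdge_of_nat.
Proof. by case. Qed.
HB.instance Definition _ := Countable.copy intEdge (can_type nat_of_intEdgeK).
Lemma intEdge_enumP : Finite.axiom [:: DiagUpper; DiagLower; UpperLower].
Proof. by case. Qed.
HB.instance Definition _ := isFinite.Build intEdge intEdge_enumP.

Definition nat_of_rectDir d : nat :=
  match d with North => 0 | South => 1 | West => 2 | East => 3 end.
Definition rectDir_of_nat := nth North [:: North; South; West; East].
Lemma nat_of_rectDirK : cancel nat_of_rectDir rectDir_of_nat.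
Proof. by case. Qed.
HB.instance Definition _ := Countable.copy rectDir (can_type nat_of_rectDirK).
Lemma rectDir_enumP : Finite.axiom [:: North; South; West; East].
Proof. by case. Qed.
HB.instance Definition _ := isFinite.Build rectDir rectDir_enumP.

Definition nat_of_diagDir d : nat :=
  match d with
  | SouthWest => 0 | NorthEast => 1 | NorthWest => 2 | SouthEast => 3
  end.
Definition diagDir_of_nat :=
  nth SouthWest [:: SouthWest; NorthEast; NorthWest; SouthEast].
Lemma nat_of_diagDirK : cancel nat_of_diagDir diagDir_of_nat.
Proof. by case. Qed.
HB.instance Definition _ := Countable.copy diagDir (can_type nat_of_diagDirK).
Lemma diagDir_enumP :
  Finite.axiom [:: SouthWest; NorthEast; NorthWest; SouthEast].
Proof. by case. Qed.
HB.instance Definition _ := isFinite.Build diagDir diagDir_enumP.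

Notation edge := (extEdge + intEdge)%type.

Definition extE (e : extEdge) : edge := inl e.
Definition intE (e : intEdge) : edge := inr e.

(* [I] is the set of string indices. *)
Record config (I : Type) := Config {
  diagEdge : diagDir -> edge;
  upperEdge : rectDir -> edge;
  lowerEdge : rectDir -> edge;
  risingString : I;   (* through the diagonal vertex, south-west to north-east *)
  fallingString : I;  (* through the diagonal vertex, north-west to south-east *)
  upperString : I;
  lowerString : I
}.

Definition confL (I : Type) (i j : I) : config I := {|
  diagEdge d := match d with
    | SouthWest => extE Alpha
    | NorthEast => intE DiagUpper
    | NorthWest => extE Beta
    | SouthEast => intE DiagLower
    end;
  upperEdge d := match d with
    | North => extE Gamma
    | South => intE UpperLower
    | West => intE DiagUpper
    | East => extE Delta
    end;
  lowerEdge d := match d with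
    | North => intE UpperLower
    | South => extE Zeta
    | West => intE DiagLower
    | East => extE Epsilon
    end;
  risingString := i;
  fallingString := j;
  upperString := i;
  lowerString := j
|}.

Definition confR (I : Type) (i j : I) : config I := {|
  diagEdge d := match d with
    | SouthWest => intE DiagLower
    | NorthEast => extE Delta
    | NorthWest => intE DiagUpper
    | SouthEast => extE Epsilon
    end;
  upperEdge d := match d with
    | North => extE Gamma
    | South => intE UpperLower
    | West => extE Beta
    | East => intE DiagUpper
    end;
  lowerEdge d := match d with
    | North => intE UpperLower
    | South => extE Zeta
    | West => extE Alpha
    | East => intE DiagLower
    end;
  risingString := i;
  fallingString := j;
  upperString := j;
  lowerString := i
|}.

Definition incident (I : Type) (C : config I) (e : edge) (v : vertex) : bool :=
  match v with
  | Diag => [exists d, diagEdge C d == e]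
  | Upper => [exists d, upperEdge C d == e]
  | Lower => [exists d, lowerEdge C d == e]
  end.

(* Every internal edge joins two distinct vertices, so the endpoint to which
   its hydrogen is bonded is recorded as a vertex. *)
Notation bonding := {ffun intEdge -> vertex}.

(* Only meaningful when [e] is incident to [v]: an external edge has a single
   vertex of the configuration on it. *)
Definition bonded (S : {set extEdge}) (s : bonding) (v : vertex) (e : edge) :
    bool :=
  match e with
  | inl e' => e' \in S
  | inr e' => s e' == v
  end.

Section States.
Variables (I : Type) (C : config I) (S : {set extEdge}) (s : bonding).

Definition diagBonds : {set diagDir} :=
  [set d | bonded S s Diag (diagEdge C d)].
Definition upperBonds : {set rectDir} :=
  [set d | bonded S s Upper (upperEdge C d)].
Definition lowerBonds : {set rectDir} :=
  [set d | bonded S s Lower (lowerEdge C d)].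

Definition is_state : bool :=
  [&& [forall e, incident C (intE e) (s e)],
      #|diagBonds| == 2%N, #|upperBonds| == 2%N & #|lowerBonds| == 2%N].
End States.

Section Weights.
Variables (F : fieldType) (I : Type) (x : I -> F) (a : F).

Definition rectWeight (k : I) (B : {set rectDir}) : F :=
  if B == [set North; South] then x k / a
  else if B == [set North; West] then x k / a - 1
  else 1.

(* The last branch is never reached by a pair of directions. *)
Definition diagWeight (i j : I) (B : {set diagDir}) : F :=
  if B == [set SouthWest; NorthEast] then 1 / x i
  else if B == [set NorthWest; SouthEast] then 1 / x j
  else if B == [set NorthWest; NorthEast] then 1 / x i - 1 / x j
  else if B == [set SouthWest; SouthEast] then 0
  else if B == [set SouthEast; NorthEast] then 1 / x i
  else if B == [set SouthWest; NorthWest] then 1 / x j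
  else 0.

Definition stateWeight (C : config I) (S : {set extEdge}) (s : bonding) : F :=
  diagWeight (risingString C) (fallingString C) (diagBonds C S s)
  * rectWeight (upperString C) (upperBonds C S s)
  * rectWeight (lowerString C) (lowerBonds C S s).

Definition partitionFunction (C : config I) (S : {set extEdge}) : F :=
  \sum_(s : bonding | is_state C S s) stateWeight C S s.
End Weights.

(* Main.v *)
Require Import Defs.
From mathcomp Require Import all_boot all_algebra.
From mathcomp Require Import ring.
Import GRing.Theory.
Local Open Scope ring_scope.

(** Each of the three internal edges has two endpoints, so a state is a point of
    the cube [bool ^ 3]; in both configurations the same edge joins the same two
    vertices, so one parametrization serves for [L] and [R]. For each of the
    twenty boundary conditions the claim is then an identity of rational
    functions in [x i], [x j], [a], checked by clearing denominators. *)

Section ExplicitEnumeration.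
Context {T : finType} {s : seq T}.
Hypothesis enum_s : Finite.axiom s.

Lemma mem_axiom_enum (d : T) : d \in s.
Proof. by rewrite -has_pred1 has_count enum_s. Qed.

(** Over an explicit list, a cardinal becomes a sum of membership bits, which simplification can
    evaluate. *)
Lemma card_axiom_enum (A : {set T}) : #|A| = count (mem A) s.
Proof.
rewrite cardE -size_filter; apply/perm_size/uniq_perm.
- exact: enum_uniq.
- by apply/filter_uniq/count_mem_uniq => d; rewrite enum_s mem_axiom_enum.
by move=> d; rewrite mem_enum mem_filter mem_axiom_enum andbT.
Qed.

Lemma exists_axiom_enum (P : pred T) : [exists d, P d] = has P s.
Proof.
apply/existsP/hasP => [[d Pd]|[d _ Pd]]; exists d => //.
exact: mem_axiom_enum.
Qed.

Lemma forall_axiom_enum (P : pred T) : [forall d, P d] = all P s.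
Proof.
apply/forallP/allP => [P_all d _|P_all d]; first exact: P_all.
exact/P_all/mem_axiom_enum.
Qed.

Lemma eqset_axiom_enum (A B : {set T}) :
  (A == B) = all (fun d => (d \in A) == (d \in B)) s.
Proof.
rewrite -forall_axiom_enum; apply/eqP/forallP => [-> //|eqAB].
by apply/setP => d; apply/eqP.
Qed.

End ExplicitEnumeration.

Definition endpoint (e : intEdge) (b : bool) : vertex :=
  match e with
  | DiagUpper => if b then Diag else Upper
  | DiagLower => if b then Diag else Lower
  | UpperLower => if b then Upper else Lower
  end.

Definition orientation (p : bool * bool * bool) : bonding :=
  [ffun e => endpoint e
     match e with
     | DiagUpper => p.1.1 | DiagLower => p.1.2 | UpperLower => p.2
     end].

(** A vertex that is not an endpoint of the edge is read as [false], so this inverts [orientation]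
    only on bondings that respect incidence. *)
Definition orientation_inv (s : bonding) : bool * bool * bool :=
  (s DiagUpper == Diag, s DiagLower == Diag, s UpperLower == Upper).

Lemma orientationK : cancel orientation orientation_inv.
Proof. by case=> [[[] []] []]; rewrite /orientation_inv !ffunE. Qed.

(** The property shared by $L$ and $R$ that lets a single reindexing of the state sum serve both. *)
Definition standard_incidence {I : Type} (C : config I) :=
  forall e v,
    incident C (intE e) v = (v == endpoint e true) || (v == endpoint e false).

Lemma standard_incidence_confL (I : Type) (i j : I) :
  standard_incidence (confL i j).
Proof.
by case; case; rewrite /= ?(exists_axiom_enum rectDir_enumP)
  ?(exists_axiom_enum diagDir_enumP).
Qed.

Lemma standard_incidence_confR (I : Type) (i j : I) :
  standard_incidence (confR i j).
Proof.
by case; case; rewrite /= ?(exists_axiom_enum rectDir_enumP)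
  ?(exists_axiom_enum diagDir_enumP).
Qed.

Section PartitionFunction.
Variables (F : fieldType) (I : Type) (x : I -> F) (a : F).

Lemma rectWeightE (k : I) (B : {set rectDir}) :
  rectWeight x a k B =
  match North \in B, South \in B, West \in B, East \in B with
  | true, true, false, false => x k / a
  | true, false, true, false => x k / a - 1
  | _, _, _, _ => 1
  end.
Proof.
rewrite /rectWeight !(eqset_axiom_enum rectDir_enumP) /= !inE /=.
by do 4!case: (_ \in B).
Qed.

Lemma diagWeightE (i j : I) (B : {set diagDir}) :
  diagWeight x i j B =
  match SouthWest \in B, NorthEast \in B, NorthWest \in B, SouthEast \in B with
  | true, true, false, false => 1 / x i
  | false, false, true, true => 1 / x j
  | false, true, true, false => 1 / x i - 1 / x j
  | false, true, false, true => 1 / x i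
  | true, false, true, false => 1 / x j
  | _, _, _, _ => 0
  end.
Proof.
rewrite /diagWeight !(eqset_axiom_enum diagDir_enumP) /= !inE /=.
by do 4!case: (_ \in B).
Qed.

Lemma orientation_invK (C : config I) (S : {set extEdge}) (s : bonding) :
  standard_incidence C -> is_state C S s -> orientation (orientation_inv s) = s.
Proof.
move=> stdC /andP[/forallP inc _]; apply/ffunP => e; rewrite ffunE.
by have := inc e; rewrite stdC /orientation_inv; case: e => /=; case: (s _).
Qed.

Lemma partitionFunction_orientation (C : config I) (S : {set extEdge}) :
  standard_incidence C ->
  partitionFunction x a C S =
  \sum_(p : bool) \sum_(q : bool) \sum_(r : bool)
    let s := orientation (p, q, r) in
    if [&& #|diagBonds C S s| == 2%N, #|upperBonds C S s| == 2%N
         & #|lowerBonds C S s| == 2%N]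
    then stateWeight x a C S s else 0.
Proof.
move=> stdC; rewrite /partitionFunction.
(* The inverse law is required only on states, where incidence leaves two values for each internal
   edge. *)
rewrite (reindex_onto orientation orientation_inv); last first.
  by move=> s; apply: orientation_invK.
rewrite pair_bigA pair_bigA big_mkcond; apply: eq_bigr => [[[p q] r]] _ /=.
rewrite orientationK eqxx andbT /is_state.
(* Every point of the cube respects incidence, so only the three cardinality conditions survive. *)
have -> // : [forall e, incident C (intE e) (orientation (p, q, r) e)].
apply/forallP => e; rewrite stdC ffunE.
by case: (match e with DiagUpper => _ | _ => _ end); rewrite eqxx ?orbT.
Qed.

End PartitionFunction.

Theorem mainTheorem3 (F : fieldType) (I : Type) (x : I -> F) (a : F) (i j : I)
    (hxi : x i != 0) (hxj : x j != 0) (ha : a != 0)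
    (S : {set extEdge}) (hS : #|S| = 3%N) :
  partitionFunction x a (confL i j) S = partitionFunction x a (confR i j) S.
Proof.
rewrite !partitionFunction_orientation;
  [|exact: standard_incidence_confR|exact: standard_incidence_confL].
rewrite !big_bool /stateWeight !diagWeightE !rectWeightE.
rewrite !(card_axiom_enum rectDir_enumP) !(card_axiom_enum diagDir_enumP) /=.
(* Internal bonds become constants, so each side depends on [S] only through six membership bits. *)
rewrite !inE /= !ffunE /=.
move: hS; rewrite (card_axiom_enum extEdge_enumP) /=.
(* Of the 64 bit patterns, the 44 whose sum is not three contradict the hypothesis on $|S|$. *)
case: (Alpha \in S); case: (Beta \in S); case: (Gamma \in S);
case: (Delta \in S); case: (Epsilon \in S); case: (Zeta \in S) => //= _.
all: rewrite ?addr0 ?add0r ?mulr1 ?mul1r ?mul0r.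
(* The only denominators are [x i], [x j] and [a], all nonzero by hypothesis. *)
all: by [] || by field; rewrite ?hxi ?hxj ?ha.
Qed.
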